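(* Let $G\cong(0,1,0,1,\ldots,0,1)$ be the threshold graph of even order $n\ge 4$ whose creation sequence alternates $0,1$. Then $q(G)=3$. Moreover, every supergraph $H$ of $G$ on the same vertex set satisfies $q(H)\le 3$.
   Context: For a simple graph $G$ on $n$ vertices, $S(G)$ is the set of all real symmetric $n\times n$ matrices $A=(a_{ij})$ such that for $i\neq j$, $a_{ij}\neq 0$ if and only if $ij\in E(G)$ (diagonal entries are unrestricted). $q(A)$ is the number of distinct eigenvalues of $A$ and $q(G)=\min\{q(A): A\in S(G)\}$. The notation $G\cong(b_1,\ldots,b_n)$, with $b_i\in\{0,1\}$ and $b_1=0$, means that $G$ is the threshold graph with creation sequence $(b_1,\ldots,b_n)$: its vertices are $v_1,\ldots,v_n$ and, for $i<j$, $v_i$ and $v_j$ are adjacent if and only if $b_j=1$. A supergraph of $G$ on the same vertex set is a graph $H$ with $V(H)=V(G)$ and $E(G)\subseteq E(H)$. *)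

(* Defs.v *)
From mathcomp Require Import all_boot all_order all_algebra.
From mathcomp Require Import finmap.
From mathcomp Require Import all_classical all_reals.

Set Implicit Arguments.
Unset Strict Implicit.
Unset Printing Implicit Defensive.

Import Order.TTheory GRing.Theory Num.Theory.
Local Open Scope ring_scope.

Record sgraph (n : nat) := SGraph {
  adj : rel 'I_n;
  adj_sym : symmetric adj;
  adj_irrefl : irreflexive adj
}.

Definition supergraph n (H G : sgraph n) : Prop :=
  forall i j, adj G i j -> adj H i j.

(* [v] enumerates the vertices: [v i] is the vertex added at step [i], counted
   from 0.  The first entry of [b] must be 0 but does not affect adjacency. *)
Definition threshold n (b : n.-tuple bool) (G : sgraph n) : Prop :=
  head false b = false /\
  exists2 v : 'I_n -> 'I_n, injective v
    & forall i j : 'I_n, (i < j)%N -> adj G (v i) (v j) = tnth b j.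

(* With steps counted from 0, the entry at step [i] is 1 iff [i] is odd. *)
Definition alternating n : n.-tuple bool := [tuple odd i | i < n].

Definition in_S (R : realType) n (G : sgraph n) (A : 'M[R]_n) : Prop :=
  A^T = A /\ forall i j, i != j -> (A i j != 0) = adj G i j.

(* [fset_set] is the empty set on infinite sets, but a matrix has only finitely
   many eigenvalues; those of a real symmetric matrix are all real. *)
Definition q_mx (R : realType) n (A : 'M[R]_n) : nat :=
  #|` fset_set [set a : R | eigenvalue A a]%classic |.

Lemma q_attained (R : realType) n (G : sgraph n) :
  exists k : nat, `[< exists2 A : 'M[R]_n, in_S G A & q_mx A = k >].
Proof.
pose A : 'M[R]_n := \matrix_(i, j) (adj G i j)%:R.
exists (q_mx A); apply/asboolP; exists A => //; split.
  by apply/matrixP => i j; rewrite !mxE adj_sym.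
by move=> i j _; rewrite mxE pnatr_eq0 eqb0 negbK.
Qed.

Definition q_graph (R : realType) n (G : sgraph n) : nat :=
  ex_minn (q_attained R G).

(* Main.v *)
Require Import Defs.
From mathcomp Require Import all_boot all_order all_algebra.
From mathcomp Require Import finmap.
From mathcomp Require Import all_classical all_reals.
From mathcomp Require Import sesquilinear spectral complex.
From mathcomp Require Import topology normedtype realfun.
From mathcomp Require Import ring lra zify.

(** Write n = 2m; the vertices added at odd steps form a clique u_1, ..., u_m,
    those added at even steps an independent set w_1, ..., w_m, and u_j ~ w_i
    exactly when i <= j.

    Upper bound. If D is symmetric and invertible and
    B^T B = a D - D^2 + z^T z, then [B D^-1 B^T, B; B^T, D] = U D U^T with
    U = [B D^-1; I], and D U^T U = a I + z^T z D^-1 is a rank one perturbation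
    of a I, so its eigenvalues are 0, a and one more number. Rows of B are
    indexed by the u_j and columns by the w_i. When H = G, B is a lower
    triangular matrix and D is diagonal. For a supergraph H, put t times the
    prescribed pattern above the diagonal of B and off the diagonal of D;
    for small t > 0 the lower triangle of B can still be solved for, one column
    at a time, each diagonal entry being the root of a quadratic equation. The
    entries that have to be nonzero are close to positive limits.

    Lower bound. With at most two eigenvalues a and b, a symmetric matrix
    satisfies (A - a)(A - b) = 0. But w_1 and w_m are not adjacent and have u_m
    as their only common neighbour, so the (w_1, w_m) entry of this product is
    A(w_1, u_m) A(u_m, w_m), which is not zero. *)

Set Implicit Arguments.
Unset Strict Implicit.
Unset Printing Implicit Defensive.

Import Order.TTheory GRing.Theory Num.Theory.
Import numFieldNormedType.Exports.
Local Open Scope ring_scope.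
Local Open Scope classical_set_scope.

(** * Eigenvalues *)

Lemma finite_eigenvalue (F : fieldType) n (A : 'M[F]_n) :
  finite_set [set a : F | eigenvalue A a]%classic.
Proof.
apply: contrapT => /(infinite_set_fset (size (char_poly A))) [B BA].
apply/negP; rewrite -ltnNge; apply: max_poly_roots.
- exact/monic_neq0/char_poly_monic.
- by apply/allP => a aB; rewrite -eigenvalue_root_char; apply: BA.
- exact: fset_uniq.
Qed.

(** Applied to an eigenvector for c, the identity gives (c - a)(c - b)c = 0, so c is one of a, b,
    0. *)
Lemma q_mx_le3 (R : realType) n (A : 'M[R]_n) a b :
  (A - a%:M) *m (A - b%:M) *m A = 0 -> (q_mx A <= 3)%N.
Proof.
move=> A0; rewrite /q_mx -[3%N]/(size [:: a; b; 0]).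
apply: uniq_leq_size; first exact: fset_uniq.
move=> c; rewrite in_fset_set; last exact: finite_eigenvalue.
rewrite inE => /= /eigenvalueP[v vA v0].
have /esym/eqP : v *m ((A - a%:M) *m (A - b%:M) *m A)
    = ((c - a) * (c - b) * c) *: v.
  have vAB d : v *m (A - d%:M) = (c - d) *: v.
    by rewrite mulmxBr vA mul_mx_scalar scalerBl.
  by rewrite !mulmxA !(vAB, =^~ scalemxAl, vA) !scalerA; congr (_ *: _); ring.
rewrite A0 mulmx0 scaler_eq0 (negPf v0) orbF !mulf_eq0 !subr_eq0 !inE.
by rewrite orbA.
Qed.

Lemma q_mx_le2_eigenvalue (R : realType) n (A : 'M[R]_n) :
  (q_mx A <= 2)%N ->
  exists a b, forall c, eigenvalue A c -> (c == a) || (c == b).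
Proof.
rewrite /q_mx => q2; set s := fset_set _ in q2.
have sE c : eigenvalue A c -> c \in enum_fset s.
  by move=> Ac; rewrite in_fset_set ?inE//; exact: finite_eigenvalue.
move: q2 sE; rewrite /=; case: (enum_fset s) => [|a [|b []]]//= _ sE.
- by exists 0, 0 => c /sE.
- by exists a, a => c /sE; rewrite !inE orbb.
- by exists a, b => c /sE; rewrite !inE.
Qed.

(** By the spectral theorem over [R[i]], A is diagonalizable with real diagonal [d]. Each entry of
    [d] is then an eigenvalue of A over R, and the product of the two shifted diagonal matrices
    vanishes entry by entry. *)
Lemma sym_two_eigenvalues (R : rcfType) n (A : 'M[R]_n) a b : A^T = A ->
  (forall c, eigenvalue A c -> (c == a) || (c == b)) ->
  (A - a%:M) *m (A - b%:M) = 0.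
Proof.
move=> Asym Aev; pose f := real_complex R.
apply: (@map_mx_inj _ _ f); rewrite map_mx0 map_mxM !map_mxB !map_scalar_mx/=.
set Ac := map_mx f A.
have Ah : Ac \is hermsymmx.
  apply: realsym_hermsym.
    apply/is_hermitianmxP; rewrite expr0 scale1r map_mx_id// /Ac map_trmx.
    by rewrite Asym.
  by apply/mxOverP => i j; rewrite mxE; apply/complex_realP; exists (A i j).
have /hermitian_normalmx/orthomx_spectralP := Ah.
have /mxOverP := hermitian_spectral_diag_real Ah.
have := spectral_unit Ac.
set P := spectralmx Ac; set d := spectral_diag Ac => Pu dreal AcE.
have PA : P *m Ac = diag_mx d *m P by rewrite {1}AcE !mulmxA mulmxV// mul1mx.
have dE i : (d 0 i == f a) || (d 0 i == f b).
  have /complex_realP[c dc] := dreal 0 i.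
  (* Row i of P is an eigenvector for [d 0 i], nonzero since P is invertible. *)
  have /Aev : eigenvalue A c.
    rewrite -(eigenvalue_map f); apply/eigenvalueP; exists (row i P).
      by rewrite -row_mul PA row_mul row_diag_mx dc -scalemxAl -rowE.
    apply/negP => /eqP r0; have := row_free_unit P; rewrite Pu => /row_freeP[Q].
    move=> /(congr1 (row i)); rewrite row_mul r0 mul0mx => /rowP/(_ i).
    by rewrite !mxE eqxx => /esym/eqP; rewrite oner_eq0.
  by rewrite dc => /orP[/eqP->|/eqP->]; rewrite eqxx ?orbT.
have AB e : Ac - e%:M = invmx P *m (diag_mx d - e%:M) *m P.
  by rewrite mulmxBr mulmxBl -AcE mul_mx_scalar -scalemxAl mulVmx// scalemx1.
rewrite !AB -!mulmxA (mulmxA P) mulmxV// mul1mx !mulmxA.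
rewrite -(mulmxA (invmx P)) (_ : _ *m (diag_mx d - _) = 0) ?mulmx0 ?mul0mx//.
rewrite -!diag_const_mx -!linearB mulmx_diag 
  -[RHS](@linear0 _ _ _ _ (@diag_mx _ n)).
congr diag_mx; apply/rowP => i; rewrite !mxE; apply/eqP.
by rewrite mulf_eq0 !subr_eq0.
Qed.

(** Writing A = U V and moving both factors past U turns the product into U (VU - a)(VU - b) V. Here
    VU - a = W has rank at most one, with W^2 = (b - a) W, so the middle is W (W - (b - a)) = 0. *)
Lemma block_annihilated (R : comUnitRingType) m (B D : 'M[R]_m) (z : 'rV_m) a :
  D \in unitmx -> B^T *m B = a *: D - D *m D + z^T *m z ->
  let A := block_mx (B *m invmx D *m B^T) B B^T D in
  let b := a + (z *m invmx D *m z^T) 0 0 in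
  (A - a%:M) *m (A - b%:M) *m A = 0.
Proof.
move=> Du BB A b.
pose U := col_mx (B *m invmx D) 1%:M.
pose V := row_mx B^T D.
have AE : A = U *m V.
  by rewrite mul_col_row !mul1mx mulmxKV.
pose W := z^T *m z *m invmx D.
have VU : V *m U = a%:M + W.
  rewrite mul_row_col mulmx1 mulmxA BB !mulmxDl mulNmx.
  by rewrite -scalemxAl mulmxV// mulmxK// scalemx1 addrAC subrK.
have WW : W *m W = W *m ((z *m invmx D *m z^T) 0 0)%:M.
  rewrite mul_mx_scalar /W -!mulmxA (mulmxA (invmx D)) (mulmxA z).
  rewrite [z *m _ in LHS]mulmxA.
  rewrite [X in z^T *m (X *m _)]mx11_scalar mul_scalar_mx -scalemxAr.
  by rewrite !mulmxA.
have AU c : (A - c%:M) *m U = U *m (V *m U - c%:M).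
  by rewrite AE mulmxBl mulmxBr mulmxA mul_scalar_mx mul_mx_scalar.
rewrite {3}AE mulmxA -(mulmxA (A - _)) AU mulmxA AU VU.
rewrite -(mulmxA U) (_ : _ *m (_ - b%:M) = 0) ?mulmx0 ?mul0mx//.
rewrite addrAC subrr add0r /b (raddfD (@scalar_mx R m)) opprD addrACA subrr add0r.
by rewrite mulmxBr WW subrr.
Qed.

(** * Entrywise limits of matrices *)

Definition mx_cvg (R : realType) (T : Type) (F : set_system T) m n
    (M : T -> 'M[R]_(m, n)) (M0 : 'M[R]_(m, n)) :=
  forall i j, M t i j @[t --> F] --> M0 i j.

Section MatrixLimits.
Context (R : realType) (T : Type) (F : set_system T) {FF : Filter F}.

Lemma cvg_big_sum (I : Type) (r : seq I) (P : pred I) (f : I -> T -> R)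
    (l : I -> R) :
  (forall i, P i -> f i t @[t --> F] --> l i) ->
  \sum_(i <- r | P i) f i t @[t --> F] --> \sum_(i <- r | P i) l i.
Proof.
move=> fl; elim: r => [|i r IH].
  by under eq_fun do rewrite big_nil; rewrite big_nil; exact: cvg_cst.
under eq_fun do rewrite big_cons; rewrite big_cons.
by case: ifPn => // Pi; apply: cvgD => //; exact: fl.
Qed.

Lemma cvg_big_prod (I : Type) (r : seq I) (P : pred I) (f : I -> T -> R)
    (l : I -> R) :
  (forall i, P i -> f i t @[t --> F] --> l i) ->
  \prod_(i <- r | P i) f i t @[t --> F] --> \prod_(i <- r | P i) l i.
Proof.
move=> fl; elim: r => [|i r IH].
  by under eq_fun do rewrite big_nil; rewrite big_nil; exact: cvg_cst.
under eq_fun do rewrite big_cons; rewrite big_cons.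
by case: ifPn => // Pi; apply: cvgM => //; exact: fl.
Qed.

Lemma mx_cvg_cst m n (M : 'M[R]_(m, n)) : mx_cvg F (fun=> M) M.
Proof. by move=> i j; exact: cvg_cst. Qed.

Lemma mx_cvgB m n (M N : T -> 'M[R]_(m, n)) M0 N0 :
  mx_cvg F M M0 -> mx_cvg F N N0 -> mx_cvg F (fun t => M t - N t) (M0 - N0).
Proof.
move=> MM NN i j; rewrite !mxE; under eq_fun do rewrite !mxE.
exact: cvgB.
Qed.

Lemma mx_cvgD m n (M N : T -> 'M[R]_(m, n)) M0 N0 :
  mx_cvg F M M0 -> mx_cvg F N N0 -> mx_cvg F (fun t => M t + N t) (M0 + N0).
Proof.
move=> MM NN i j; rewrite !mxE; under eq_fun do rewrite !mxE.
exact: cvgD.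
Qed.

Lemma mx_cvgZ m n (f : T -> R) (a : R) (M : T -> 'M[R]_(m, n)) M0 :
  f t @[t --> F] --> a -> mx_cvg F M M0 ->
  mx_cvg F (fun t => f t *: M t) (a *: M0).
Proof.
move=> fa MM i j; rewrite !mxE; under eq_fun do rewrite !mxE.
exact: cvgM.
Qed.

Lemma mx_cvgM m n p (M : T -> 'M[R]_(m, n)) (N : T -> 'M[R]_(n, p)) M0 N0 :
  mx_cvg F M M0 -> mx_cvg F N N0 -> mx_cvg F (fun t => M t *m N t) (M0 *m N0).
Proof.
move=> MM NN i j; rewrite !mxE; under eq_fun do rewrite !mxE.
by apply: cvg_big_sum => k _; exact: cvgM.
Qed.

Lemma mx_cvg_tr m n (M : T -> 'M[R]_(m, n)) M0 :
  mx_cvg F M M0 -> mx_cvg F (fun t => (M t)^T) M0^T.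
Proof.
by move=> MM i j; rewrite mxE; under eq_fun do rewrite mxE; exact: MM.
Qed.

Lemma mx_cvg_det n (M : T -> 'M[R]_n) M0 :
  mx_cvg F M M0 -> \det (M t) @[t --> F] --> \det M0.
Proof.
move=> MM; apply: cvg_big_sum => s _; apply: cvgM; first exact: cvg_cst.
by apply: cvg_big_prod.
Qed.

Lemma mx_cvg_unit n (M : T -> 'M[R]_n) M0 : M0 \in unitmx ->
  mx_cvg F M M0 -> \forall t \near F, M t \in unitmx.
Proof.
rewrite unitmxE unitfE => u0 /mx_cvg_det/cvgr_neq0 /(_ u0).
by apply: filterS => t; rewrite unitmxE unitfE.
Qed.

(** By Cramer's formula the inverse is the adjugate over the determinant. [invmx] agrees with this
    only on invertible matrices, hence near [F]. *)
Lemma mx_cvgV n (M : T -> 'M[R]_n) M0 : M0 \in unitmx ->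
  mx_cvg F M M0 -> mx_cvg F (fun t => invmx (M t)) (invmx M0).
Proof.
move=> u0 MM.
have adj : mx_cvg F (fun t => (\det (M t))^-1 *: \adj (M t)) (invmx M0).
  rewrite /invmx u0; apply: mx_cvgZ.
    by apply: cvgV; [rewrite -unitfE -unitmxE|exact: mx_cvg_det].
  move=> i j; rewrite !mxE; under eq_fun do rewrite !mxE.
  apply: cvgM; first exact: cvg_cst.
  apply: mx_cvg_det => k l; rewrite !mxE; under eq_fun do rewrite !mxE.
  exact: MM.
move=> i j; apply: cvg_trans (adj i j); apply: near_eq_cvg.
by have := mx_cvg_unit u0 MM; apply: filterS => t ut; rewrite /invmx ut.
Qed.

Lemma mx_cvg_block m1 m2 n1 n2 (A : T -> 'M[R]_(m1, n1)) (B : T -> 'M[R]_(m1, n2))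
    (C : T -> 'M[R]_(m2, n1)) (D : T -> 'M[R]_(m2, n2)) A0 B0 C0 D0 :
  mx_cvg F A A0 -> mx_cvg F B B0 -> mx_cvg F C C0 -> mx_cvg F D D0 ->
  mx_cvg F (fun t => block_mx (A t) (B t) (C t) (D t)) (block_mx A0 B0 C0 D0).
Proof.
move=> AA BB CC DD i j.
case: (split_ordP i) => i' ->; case: (split_ordP j) => j' ->.
- by rewrite block_mxEul; under eq_fun do rewrite block_mxEul; exact: AA.
- by rewrite block_mxEur; under eq_fun do rewrite block_mxEur; exact: BB.
- by rewrite block_mxEdl; under eq_fun do rewrite block_mxEdl; exact: CC.
- by rewrite block_mxEdr; under eq_fun do rewrite block_mxEdr; exact: DD.
Qed.

(** The two equations are the first row of the Gram matrix of [x, r; y, L], to be solved for x and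
    y. The second gives y as an affine function of x; the first then becomes a quadratic in x that
    tends to x^2 = x0^2 because r tends to 0. Its larger root tends to x0 > 0. *)
Lemma cholesky_column_step m (x0 : R) (y0 : 'cV[R]_m) (L0 : 'M[R]_m)
    (r s : T -> 'rV[R]_m) (c : T -> R) (L : T -> 'M[R]_m) :
  0 < x0 -> L0 \in unitmx -> mx_cvg F r 0 -> mx_cvg F s (y0^T *m L0) ->
  c t @[t --> F] --> x0 ^+ 2 + (y0^T *m y0) 0 0 -> mx_cvg F L L0 ->
  exists x : T -> R, exists2 y : T -> 'cV[R]_m,
    x t @[t --> F] --> x0 /\ mx_cvg F y y0 &
    \forall t \near F, x t ^+ 2 + ((y t)^T *m y t) 0 0 = c t /\
                       x t *: r t + (y t)^T *m L t = s t.
Proof.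
move=> x0pos L0u rcvg scvg ccvg Lcvg.
pose e t := r t *m invmx (L t); pose a t := s t *m invmx (L t).
have Vcvg := mx_cvgV L0u Lcvg.
have ecvg : mx_cvg F e 0.
  by have := mx_cvgM rcvg Vcvg; rewrite mul0mx.
have acvg : mx_cvg F a y0^T.
  by have := mx_cvgM scvg Vcvg; rewrite mulmxK.
pose p t : R := (e t *m (e t)^T) 0 0; pose q t : R := (a t *m (e t)^T) 0 0.
pose w t : R := (a t *m (a t)^T) 0 0.
have pcvg : p t @[t --> F] --> (0 : R).
  by have := mx_cvgM ecvg (mx_cvg_tr ecvg); move=> /(_ 0 0); rewrite mul0mx mxE.
have qcvg : q t @[t --> F] --> (0 : R).
  by have := mx_cvgM acvg (mx_cvg_tr ecvg); move=> /(_ 0 0); rewrite trmx0 mulmx0 mxE.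
have wcvg : w t @[t --> F] --> ((y0^T *m y0) 0 0 : R).
  by have := mx_cvgM acvg (mx_cvg_tr acvg); move=> /(_ 0 0); rewrite trmxK.
(* With y^T = a - x e, the norm condition on the column (x, y) reads
   (1 + p) x^2 - 2 q x + w - c = 0, of reduced discriminant disc. *)
pose disc t := q t ^+ 2 - (1 + p t) * (w t - c t).
have p1cvg : 1 + p t @[t --> F] --> (1 : R).
  by rewrite -[X in _ --> X]addr0; apply: cvgD => //; exact: cvg_cst.
have discvg : disc t @[t --> F] --> x0 ^+ 2.
  rewrite [X in _ --> X](_ : _ = 0 * 0 - 1 * ((y0^T *m y0) 0 0 -
     (x0 ^+ 2 + (y0^T *m y0) 0 0))); last by ring.
  by apply: cvgB; [exact: cvgM|apply: cvgM => //; exact: cvgB].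
pose x t := (q t + Num.sqrt (disc t)) / (1 + p t).
have xcvg : x t @[t --> F] --> x0.
  rewrite [X in _ --> X](_ : _ = (0 + Num.sqrt (x0 ^+ 2)) / 1); last first.
    by rewrite sqrtr_sqr gtr0_norm// add0r divr1.
  apply: cvgM; last by apply: cvgV => //; rewrite oner_eq0.
  apply: cvgD => //; apply: continuous_cvg => //; exact: sqrt_continuous.
exists x, (fun t => (a t - x t *: e t)^T); first split => //.
  have := mx_cvg_tr (mx_cvgB acvg (mx_cvgZ xcvg ecvg)).
  by rewrite scaler0 subr0 trmxK.
have dpos : \forall t \near F, 0 < disc t.
  by apply: (cvgr_gt _ discvg); rewrite exprn_gt0.
have ppos : \forall t \near F, 0 < 1 + p t by apply: (cvgr_gt _ p1cvg).
have Lu := mx_cvg_unit L0u Lcvg.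
near=> t; split; last first.
  rewrite trmxK mulmxBl -scalemxAl /a /e !mulmxKV ?subrKC//; last by near: t.
  by near: t.
have d0 : 0 < disc t by near: t.
have p0 : 1 + p t != 0 by rewrite gt_eqF//; near: t.
have ea : \tr (e t *m (a t)^T) = q t.
  by rewrite /q -trace_mx11 -mxtrace_tr trmx_mul trmxK.
rewrite trmxK -trace_mx11 mulmxBl [(_ - _)^T]linearB linearZ/= !mulmxBr.
rewrite -!scalemxAl -!scalemxAr !linearB !linearZ/= ea !trace_mx11.
rewrite -/(w t) -/(p t) -/(q t).
(* The completed square minus [disc] is 1 + p times the norm condition. *)
have /eqP : (x t * (1 + p t) - q t) ^+ 2 - disc t = 0.
  by rewrite /x divfK// [q t + _]addrC addrK sqr_sqrtr ?subrr// ltW.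
rewrite /disc [X in X == _](_ : _ = (1 + p t) *
  ((x t ^+ 2 + (w t - x t * q t - x t * (q t - x t * p t))) - c t)); last by ring.
by rewrite mulf_eq0 (negPf p0)/= subr_eq0 => /eqP <-; rewrite /GRing.scale/=; ring.
Unshelve. all: by end_near. Qed.


End MatrixLimits.

Arguments mx_cvg_cst {R T F FF m n} M.


(** For L = [x, r; y, B] the lower right block of L^T L is r^T r + B^T B, free of x and y. So B
    comes first, by induction applied to that block of S minus r^T r, and the column (x, y) is
    solved for afterwards. *)
Lemma perturbed_cholesky (R : realType) (T : Type) (F : set_system T)
    {FF : Filter F} m (L0 : 'M[R]_m) (S N : T -> 'M[R]_m) :
  (forall i j : 'I_m, (i < j)%N -> L0 i j = 0) -> (forall i, 0 < L0 i i) ->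
  (forall t, (S t)^T = S t) -> mx_cvg F S (L0^T *m L0) -> mx_cvg F N 0 ->
  exists L : T -> 'M[R]_m,
    [/\ forall t (i j : 'I_m), (i < j)%N -> L t i j = N t i j,
        mx_cvg F L L0 &
        \forall t \near F, (L t)^T *m L t = S t].
Proof.
elim: m L0 S N => [|m IH] L0 S N tri pos Ssym Scvg Ncvg.
  exists (fun=> L0); split=> [t []||]//; first exact: mx_cvg_cst.
  by apply: nearW => t; apply/matrixP => -[].
rewrite -[m.+1]/(1 + m)%N in L0 S N tri pos Ssym Scvg Ncvg *.
pose x0 := L0 0 0.
have L0E : L0 = block_mx x0%:M 0 (dlsubmx L0) (drsubmx L0).
  rewrite -[LHS]submxK; congr block_mx.
    by apply/matrixP => i j; rewrite !ord1 !mxE !lshift0 mulr1n.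
  by apply/matrixP => i j; rewrite !mxE tri// !ord1.
set y0 := dlsubmx L0 in L0E; set L0' := drsubmx L0 in L0E.
have tri' (i j : 'I_m) : (i < j)%N -> L0' i j = 0.
  by move=> ij; rewrite !mxE tri.
have pos' i : 0 < L0' i i by rewrite !mxE.
have L0'u : L0' \in unitmx.
  rewrite unitmxE unitfE det_trig; last exact/is_trig_mxP.
  by apply/prodf_neq0 => i _; rewrite gt_eqF.
have S0E : L0^T *m L0 = block_mx ((x0 ^+ 2)%:M + y0^T *m y0) (y0^T *m L0')
    (L0'^T *m y0) (L0'^T *m L0').
  rewrite L0E tr_block_mx mulmx_block !trmx0 !mul0mx !mulmx0 !add0r.
  by rewrite tr_scalar_mx -scalar_mxM expr2.
rewrite S0E in Scvg.
pose r t := ursubmx (N t); pose s t := ursubmx (S t).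
have rcvg : mx_cvg F r 0.
  move=> i j; have := Ncvg (lshift m i) (rshift 1 j).
  by rewrite !mxE; under [in X in _ -> X]eq_fun do rewrite !mxE.
have scvg : mx_cvg F s (y0^T *m L0').
  move=> i j; have := Scvg (lshift m i) (rshift 1 j).
  by rewrite block_mxEur; under [in X in _ -> X]eq_fun do rewrite !mxE.
have ccvg : S t 0 0 @[t --> F] --> x0 ^+ 2 + (y0^T *m y0) 0 0.
  have := Scvg (lshift m 0) (lshift m 0).
  by rewrite block_mxEul [X in _ --> X]mxE [X in _ --> (X + _)]mxE lshift0.
have drcvg (M : T -> 'M[R]_(1 + m)) M0 : mx_cvg F M M0 ->
    mx_cvg F (fun t => drsubmx (M t)) (drsubmx M0).
  move=> MM i j; rewrite !mxE; under eq_fun do rewrite !mxE; exact: MM.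
have [|||B [Btri Bcvg Beq]] := IH L0' (fun t => drsubmx (S t) - (r t)^T *m r t)
  (fun t => drsubmx (N t)) tri' pos'.
- by move=> t; rewrite linearB/= trmx_mul trmxK trmx_drsub Ssym.
- have := mx_cvgB (drcvg _ _ Scvg) (mx_cvgM (mx_cvg_tr rcvg) rcvg).
  by rewrite block_mxKdr mulmx0 subr0; apply.
- have := drcvg _ _ Ncvg; rewrite (_ : drsubmx 0 = 0)//.
  by apply/matrixP => i j; rewrite !mxE.
have [x [y [xcvg ycvg] xyE]] :=
  cholesky_column_step (pos _) L0'u rcvg scvg ccvg Bcvg.
exists (fun t => block_mx (x t)%:M (r t) (y t) (B t)); split.
- move=> t i j; case: (split_ordP i) => i' ->; case: (split_ordP j) => j' ->.
  + by rewrite !ord1.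
  + by rewrite block_mxEur !mxE.
  + by rewrite /= ord1.
  + by rewrite block_mxEdr /= ltn_add2l => /Btri->; rewrite !mxE.
- rewrite L0E; apply: mx_cvg_block => // i j.
  by rewrite !ord1 mxE; under eq_fun do rewrite mxE.
- near=> t.
  have [xyc xys] : x t ^+ 2 + ((y t)^T *m y t) 0 0 = S t 0 0 /\
    x t *: r t + (y t)^T *m B t = s t by near: t.
  have BB : (B t)^T *m B t = drsubmx (S t) - (r t)^T *m r t by near: t.
  rewrite tr_block_mx mulmx_block tr_scalar_mx -[RHS]submxK; congr block_mx.
  + rewrite -scalar_mxM -expr2; apply/matrixP => i j.
    by rewrite !ord1 [RHS]mxE [in RHS]mxE !lshift0 -xyc [LHS]mxE mxE.
  + by rewrite mul_scalar_mx.
  + rewrite -[LHS]trmxK linearD/= !trmx_mul trmxK tr_scalar_mx mul_scalar_mx.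
    by rewrite !trmxK xys trmx_ursub Ssym.
  + by rewrite BB subrKC.
Unshelve. all: by end_near. Qed.

(** * The construction *)

(* The triangular entries are chosen so that the off-diagonal entries of the Gram
   matrix are all (m + 1)^2, those of z^T z for constant z. *)
Definition half_graph_mx (R : realType) m : 'M[R]_m :=
  \matrix_(j, i) if (i < j)%N then 1 else
    if i == j then m.+1%:R ^+ 2 - \sum_(k < m) (i < k)%:R else 0.

Section HalfGraph.
Context (R : realType) (m : nat).
Notation L0 := (half_graph_mx R m).

Lemma half_graph_mx_tri (i j : 'I_m) : (i < j)%N -> L0 i j = 0.
Proof. by move=> ij; rewrite mxE ltnNge ltnW//= -val_eqE/= gtn_eqF. Qed.

(** The sum subtracted on the diagonal is at most m, which is less than (m + 1)^2. *)
Lemma half_graph_mx_gt0 (i j : 'I_m) : (j <= i)%N -> 0 < L0 i j.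
Proof.
rewrite leq_eqVlt => /predU1P[/val_inj->|ji]; last by rewrite mxE ji.
rewrite mxE ltnn eqxx subr_gt0 (@le_lt_trans _ _ m%:R)//.
  rewrite -[X in X%:R]card_ord -sum1_card natr_sum.
  by apply: ler_sum => k _; case: (_ < _)%N.
by rewrite -natrX ltr_nat -[X in (X <= _)%N]expn1 leq_pexp2l.
Qed.

Lemma half_graph_mx_ge0 (i j : 'I_m) : 0 <= L0 i j.
Proof.
case: (leqP j i) => [ji|ij]; first exact/ltW/half_graph_mx_gt0.
by rewrite half_graph_mx_tri.
Qed.

(** For i < k, row j contributes 0 if j < k, the diagonal entry [L0 k k] if j = k, and 1 if j > k.
    The sum in that diagonal entry cancels the ones. *)
Lemma half_graph_mx_gram (i k : 'I_m) : i != k ->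
  (L0^T *m L0) i k = m.+1%:R ^+ 2.
Proof.
wlog ik : i k / (i < k)%N.
  move=> H ik; case: (ltngtP i k) => [lt|lt|/val_inj eq]; first exact: H.
  - by rewrite -[_ *m _]trmxK trmx_mul trmxK mxE H// eq_sym.
  - by rewrite eq eqxx in ik.
move=> _; rewrite mxE (bigD1 k)//=.
rewrite !mxE ik mul1r ltnn eqxx -[RHS](subrK (\sum_(j < m) (k < j)%:R)).
congr (_ + _); rewrite [RHS](bigD1 k)//= ltnn add0r.
apply: eq_bigr => j jk; rewrite !mxE; case: (ltngtP k j) => [kj|kj|/val_inj kj].
- by rewrite (ltn_trans ik kj) mul1r.
- by rewrite -(val_eqE k)/= gtn_eqF// mulr0.
- by rewrite kj eqxx in jk.
Qed.

End HalfGraph.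

(** Left indices are the clique vertices u_j, right indices the w_i, and [E] is the adjacency of a
    supergraph in this ordering. *)
Lemma half_graph_three_eigenvalues (R : realType) m (E : rel 'I_(m + m)) :
  symmetric E ->
  (forall i j : 'I_m, i != j -> E (lshift m i) (lshift m j)) ->
  (forall i j : 'I_m, (i <= j)%N -> E (lshift m j) (rshift m i)) ->
  exists A : 'M[R]_(m + m),
    [/\ A^T = A, forall i j, i != j -> (A i j != 0) = E i j &
        exists a b, (A - a%:M) *m (A - b%:M) *m A = 0].
Proof.
move=> Esym Euu Euw; pose L0 := half_graph_mx R m.
(* With a = 2h, the diagonal of the Gram identity for D = diag(d) asks that 2 h d - d^2 = p. The
   bound h^2 >= p makes the roots real, and [d] takes the larger one, which is positive. *)
pose p k := (L0^T *m L0) k k - m.+1%:R ^+ 2.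
pose h : R := 1 + \sum_k `|p k|.
have hp k : p k <= h ^+ 2.
  have h1 : 1 <= h by rewrite lerDl sumr_ge0.
  apply: (le_trans (ler_norm _)); apply: (@le_trans _ _ h).
    by rewrite /h (bigD1 k)//= addrCA lerDl addr_ge0// sumr_ge0.
  by rewrite expr2 ler_peMl// (le_trans _ h1).
pose d : 'rV[R]_m := \row_k (h + Num.sqrt (h ^+ 2 - p k)).
have h0 : 0 < h by rewrite ltr_pwDl// sumr_ge0.
have d0 k : 0 < d 0 k by rewrite mxE ltr_pwDl// sqrtr_ge0.
have dp k : 2 * h * d 0 k - d 0 k ^+ 2 = p k.
  have : Num.sqrt (h ^+ 2 - p k) ^+ 2 = h ^+ 2 - p k.
    by rewrite sqr_sqrtr// subr_ge0.
  by rewrite mxE; nra.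
pose D0 := diag_mx d; pose D0' := diag_mx (\row_k (d 0 k)^-1).
have DD' : D0 *m D0' = 1%:M.
  rewrite mulmx_diag -diag_const_mx; congr diag_mx; apply/rowP => k.
  by rewrite mxE [X in _ * X]mxE [RHS]mxE mulfV// gt_eqF.
have D0u : D0 \in unitmx by case: (mulmx1_unit DD').
have D0V : invmx D0 = D0' by rewrite -[RHS](mulKmx D0u) DD' mulmx1.
pose z : 'rV[R]_m := const_mx m.+1%:R.
have gramE : L0^T *m L0 = (2 * h) *: D0 - D0 *m D0 + z^T *m z.
  have zz i j : (z^T *m z) i j = m.+1%:R ^+ 2.
    by rewrite mxE big_ord1 !mxE expr2.
  apply/matrixP => i j; rewrite [RHS]mxE zz mulmx_diag.
  have [->|ij] := eqVneq i j.
    rewrite [X in _ = X + _]mxE [X in _ = X + _ + _]mxE ![in RHS]mxE eqxx !mulr1n.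
    by have := dp j; rewrite /p /D0 mxE => dpj; nra.
  rewrite half_graph_mx_gram// ![in RHS]mxE (negPf ij) !mulr0n.
  by rewrite mulr0 subr0 add0r.
pose W : 'M[R]_m := \matrix_(i, j) ((i != j) && E (rshift m i) (rshift m j))%:R.
have Wsym : W^T = W by apply/matrixP => i j; rewrite !mxE Esym eq_sym.
pose D (t : R) := D0 + t *: W.
have Dsym t : (D t)^T = D t by rewrite linearD linearZ/= tr_diag_mx Wsym.
pose S t := (2 * h) *: D t - D t *m D t + z^T *m z.
(* B receives the entries of [t *: P] above the diagonal: these are the pairs u_j, w_i with j < i,
   which [Euw] leaves open. *)
pose P : 'M[R]_m := \matrix_(j, i) (E (lshift m j) (rshift m i))%:R.
(* Finitely many conditions hold for all small t > 0; the filter is proper, so a single t satisfies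
   them together. *)
pose F := (0 : R)^'+.
have FF : ProperFilter F by exact: at_right_proper_filter.
have tcvg : t @[t --> F] --> (0 : R) by apply: cvg_at_right_filter.
have Dcvg : mx_cvg F D D0.
  have := mx_cvgD (mx_cvg_cst D0) (mx_cvgZ tcvg (mx_cvg_cst W)).
  by rewrite scale0r addr0; apply.
have Scvg : mx_cvg F S (L0^T *m L0).
  rewrite gramE; apply: mx_cvgD; last exact: mx_cvg_cst.
  apply: mx_cvgB; last exact: mx_cvgM.
  by apply: mx_cvgZ => //; exact: cvg_cst.
have Ncvg : mx_cvg F (fun t => t *: P) 0.
  by have := mx_cvgZ tcvg (mx_cvg_cst P); rewrite scale0r; apply.
have Ssym t : (S t)^T = S t.
  by rewrite /S linearD linearB linearZ/= !trmx_mul trmxK Dsym.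
have [B [BN Bcvg BS]] := perturbed_cholesky (@half_graph_mx_tri R m)
  (fun i => half_graph_mx_gt0 R (leqnn i)) Ssym Scvg Ncvg.
pose X t := B t *m invmx (D t) *m (B t)^T.
have Xcvg : mx_cvg F X (L0 *m D0' *m L0^T).
  rewrite -D0V; apply: mx_cvgM; last exact: mx_cvg_tr.
  by apply: mx_cvgM => //; exact: mx_cvgV.
(* The first column of [L0], at index [o], is positive throughout, so the sum has a positive term,
   and the other terms are nonnegative. Hence all clique entries survive for small t. *)
have X0 i j : 0 < (L0 *m D0' *m L0^T) i j.
  pose o := Ordinal (leq_ltn_trans (leq0n i) (ltn_ord i)).
  have XE k : (L0 *m D0') i k * L0^T k j = L0 i k * (d 0 k)^-1 * L0 j k.
    by rewrite mul_mx_diag [L0^T k j]mxE [X in X * _]mxE [X in _ * X * _]mxE.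
  rewrite mxE (bigD1 o)//= ltr_pwDl//.
    by rewrite XE !mulr_gt0 ?invr_gt0 ?half_graph_mx_gt0.
  apply: sumr_ge0 => k _.
  by rewrite XE !mulr_ge0 ?invr_ge0 ?half_graph_mx_ge0 ?ltW.
have Xn0 : \forall t \near F, forall i j, X t i j != 0.
  apply: filter_forall => i; apply: filter_forall => j.
  by apply: cvgr_neq0 (Xcvg i j) _; rewrite gt_eqF.
have Bn0 : \forall t \near F, forall i j : 'I_m, (j <= i)%N -> B t i j != 0.
  apply: filter_forall => i; apply: filter_forall => j.
  case: (leqP j i) => ji; last by apply: nearW.
  have Bij : \forall t \near F, B t i j != 0.
    by apply: cvgr_neq0 (Bcvg i j) _; rewrite gt_eqF ?half_graph_mx_gt0.
  exact: filterS Bij.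
have Du : \forall t \near F, D t \in unitmx by exact: mx_cvg_unit Dcvg.
have tn0 : \forall t \near F, t != 0.
  by near=> t; rewrite gt_eqF//; near: t; exact: nbhs_right_gt.
near F => t.
have tX : forall i j, X t i j != 0 by near: t.
have tB : forall i j : 'I_m, (j <= i)%N -> B t i j != 0 by near: t.
have tD : D t \in unitmx by near: t.
have t0 : t != 0 by near: t.
have tS : (B t)^T *m B t = S t by near: t.
pose A := block_mx (X t) (B t) (B t)^T (D t).
have Asym : A^T = A.
  by rewrite tr_block_mx Dsym trmxK /X !trmx_mul trmxK trmx_inv Dsym mulmxA.
have Auw (i j : 'I_m) : (A (lshift m i) (rshift m j) != 0)
    = E (lshift m i) (rshift m j).
  rewrite block_mxEur; case: (leqP j i) => ij; first by rewrite tB// Euw.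
  by rewrite BN// !mxE mulf_eq0 (negPf t0)/= pnatr_eq0 eqb0 negbK.
exists A; split => //; last first.
  by exists (2 * h), (2 * h + (z *m invmx (D t) *m z^T) 0 0);
    exact: block_annihilated.
move=> i j; case: (split_ordP i) => i' ->; case: (split_ordP j) => j' -> //.
- by rewrite (inj_eq (@lshift_inj _ _)) => ij; rewrite block_mxEul tX Euu.
- by move=> _; rewrite -Asym mxE Auw Esym.
- rewrite (inj_eq (@rshift_inj _ _)) => ij; rewrite block_mxEdr !mxE (negPf ij).
  by rewrite mulr0n add0r mulf_eq0 (negPf t0)/= pnatr_eq0 eqb0 negbK.
Unshelve. all: by end_near. Qed.

(** * Threshold graphs *)

Lemma mulmx_mxsub_bij (R : pzSemiRingType) n (g : 'I_n -> 'I_n) (A B : 'M[R]_n) :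
  bijective g -> mxsub g g (A *m B) = mxsub g g A *m mxsub g g B.
Proof.
move=> gbij; apply/matrixP => i j; rewrite !mxE (reindex g) /=; last first.
  exact: onW_bij.
by apply: eq_bigr => k _; rewrite !mxE.
Qed.

Lemma mxsub_scalar_inj (R : pzSemiRingType) n (g : 'I_n -> 'I_n) (a : R) :
  injective g -> mxsub g g a%:M = a%:M.
Proof. by move=> ginj; apply/matrixP => i j; rewrite !mxE inj_eq. Qed.

Lemma alternating_adj n (G : sgraph n) (v : 'I_n -> 'I_n) :
  (forall i j : 'I_n, (i < j)%N -> adj G (v i) (v j) = tnth (alternating n) j) ->
  forall i j : 'I_n, (i < j)%N -> adj G (v i) (v j) = odd j.
Proof. by move=> Gv i j ij; rewrite Gv// tnth_mktuple. Qed.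

(** Puts the clique first: counted from 0, u_i is added at step 2i + 1 and w_i at step 2i, so w_i
    precedes u_j exactly when i <= j. *)
Lemma odd_even_shuffle m : exists2 s : 'I_(m + m) -> 'I_(m + m), injective s &
  forall i : 'I_m, s (lshift m i) = i.*2.+1 :> nat /\ s (rshift m i) = i.*2 :> nat.
Proof.
have ltu (i : 'I_m) : (i.*2.+1 < m + m)%N by have := ltn_ord i; lia.
have ltw (i : 'I_m) : (i.*2 < m + m)%N by have := ltn_ord i; lia.
pose s (k : 'I_(m + m)) := match fintype.split k with
  | inl i => Ordinal (ltu i) | inr i => Ordinal (ltw i) end.
have sl i : s (lshift m i) = Ordinal (ltu i) by rewrite /s (unsplitK (inl i)).
have sr i : s (rshift m i) = Ordinal (ltw i) by rewrite /s (unsplitK (inr i)).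
exists s => [i j|i]; last by rewrite sl sr.
case: (split_ordP i) => i' ->; case: (split_ordP j) => j' ->;
  rewrite ?sl ?sr => /(congr1 val)/= ij; try lia; congr (_ _ _); apply: val_inj => /=; lia.
Qed.

Lemma q_graph_supergraph_le3 (R : realType) n (G H : sgraph n) :
  ~~ odd n -> threshold (alternating n) G -> supergraph H G ->
  (q_graph R H <= 3)%N.
Proof.
move=> n_even [_ [v vinj /alternating_adj Gv]] HG.
have [m nE] : exists m, n = (m + m)%N by exists n./2; lia.
subst n.
have [s sinj sE] := odd_even_shuffle m.
have phi_inj : injective (v \o s) by exact: inj_comp.
have [g gK Kg] := injF_bij phi_inj.
have gbij : bijective g by exists (v \o s).
have Huu (i j : 'I_m) : i != j ->
    adj H ((v \o s) (lshift m i)) ((v \o s) (lshift m j)).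
  wlog ij : i j / (i < j)%N => [hw|] ne.
    case: (ltngtP i j) => [lt|lt|/val_inj eq]; first exact: hw.
      by rewrite adj_sym hw// eq_sym.
    by rewrite eq eqxx in ne.
  apply: HG; rewrite /= Gv !(sE _).1 //; lia.
have Huw (i j : 'I_m) : (i <= j)%N ->
    adj H ((v \o s) (lshift m j)) ((v \o s) (rshift m i)).
  move=> ij; apply: HG; rewrite adj_sym /= Gv (sE _).1 ?(sE _).2; lia.
have [A [Asym Apat [a [b Aann]]]] := @half_graph_three_eigenvalues R m
  (fun i j => adj H ((v \o s) i) ((v \o s) j))
  (fun i j => adj_sym H _ _) Huu Huw.
rewrite /q_graph; case: ex_minnP => k _ kmin.
(* [g] inverts the relabelling [v \o s], so [mxsub g g A] is the block matrix written on the
   original vertices. Simultaneous permutation of rows and columns preserves the annihilating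
   identity. *)
apply: leq_trans (kmin (q_mx (mxsub g g A)) _) _.
  apply/asboolP; exists (mxsub g g A) => //; split=> [|i j ij].
    by rewrite trmx_mxsub Asym.
  by rewrite mxE Apat ?(bij_eq gbij)// !Kg.
apply: (@q_mx_le3 _ _ _ a b).
rewrite -[a%:M](mxsub_scalar_inj _ (bij_inj gbij)).
rewrite -[b%:M](mxsub_scalar_inj _ (bij_inj gbij)).
by rewrite -!linearB/= -!mulmx_mxsub_bij// Aann; apply/matrixP => i j; rewrite !mxE.
Qed.

Lemma q_graph_alternating_ge3 (R : realType) n (G : sgraph n) :
  ~~ odd n -> (4 <= n)%N -> threshold (alternating n) G -> (3 <= q_graph R G)%N.
Proof.
move=> n_even n_ge4 [_ [v vinj /alternating_adj Gv]].
rewrite /q_graph; case: ex_minnP => k /asboolP[A [Asym Apat] <-] _.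
rewrite ltnNge; apply/negP => /q_mx_le2_eigenvalue[a [b ab]].
have /matrixP AA := sym_two_eigenvalues Asym ab.
have lt0 : (0 < n)%N by lia.
have lt2 : (n.-2 < n)%N by lia.
have lt1 : (n.-1 < n)%N by lia.
(* Steps 0, n - 2 and n - 1 add w_1, w_m and u_m; w_1 and w_m differ because n >= 4. *)
pose w0 := v (Ordinal lt0); pose w := v (Ordinal lt2); pose u := v (Ordinal lt1).
have w0w : w0 != w by apply/eqP => /vinj/(congr1 val)/=; lia.
have w0u : w0 != u by apply/eqP => /vinj/(congr1 val)/=; lia.
have uw : u != w by apply/eqP => /vinj/(congr1 val)/=; lia.
have Aw0w : A w0 w = 0.
  apply/eqP; rewrite -[_ == _]negbK Apat// Gv/=; lia.
have Aw0u : A w0 u != 0 by rewrite Apat// Gv/=; lia.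
have Auw : A u w != 0 by rewrite Apat// adj_sym Gv/=; lia.
(* u_m is the only neighbour of w_m: step n - 2 has entry 0, and only step n - 1 comes later. *)
have Aw x : x != u -> x != w -> A x w = 0.
  have [v' vK Kv] := injF_bij vinj.
  move=> xu xw; apply/eqP; rewrite -[_ == _]negbK Apat//.
  rewrite -(Kv x) adj_sym /w; case: (ltngtP (v' x) n.-2) => vx.
  - rewrite adj_sym Gv//=; lia.
  - suff vx1 : v' x = Ordinal lt1 by rewrite /u -vx1 Kv eqxx in xu.
    by apply: val_inj => /=; have := ltn_ord (v' x); lia.
  - suff vx1 : v' x = Ordinal lt2 by rewrite /w -vx1 Kv eqxx in xw.
    exact: val_inj.
have := AA w0 w; rewrite mulmxBl !mulmxBr.
rewrite !mul_scalar_mx !mul_mx_scalar.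
rewrite !mxE Aw0w (negPf w0w) !mulr0n !mulr0 !subr0.
rewrite (bigD1 u)//= big1 ?addr0 => [/eqP|x xu].
  by rewrite mulf_eq0 (negPf Aw0u) (negPf Auw).
have [->|xw] := eqVneq x w; first by rewrite Aw0w mul0r.
by rewrite Aw// mulr0.
Qed.

Theorem theorem5p1 (R : realType) (n : nat) (G : sgraph n)
    (n_even : ~~ odd n) (n_ge4 : (4 <= n)%N)
    (G_threshold : threshold (alternating n) G) :
  q_graph R G = 3%N /\
  (forall H : sgraph n, supergraph H G -> (q_graph R H <= 3)%N).
Proof.
split; last by move=> H; exact: q_graph_supergraph_le3.
apply/eqP; rewrite eqn_leq q_graph_alternating_ge3// andbT.
exact: (q_graph_supergraph_le3 _ n_even G_threshold).
Qed.
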